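(* Let $C$ be an algebraically closed field of characteristic zero. Let $\phi:E\to F$ be an arrow of $\mathbf{MC}_{\rm rs}(C((x))/C)$. Let $\mathcal E$ and $\mathcal F$ be logarithmic models for $E$ and $F$ respectively, and assume that $\mathcal F$ is in fact a lattice. Write $\vartheta$ for all derivations in sight (those of $E$, $F$, $\mathcal E$, $\mathcal F$). (1) Let $\varrho\in\mathrm{Exp}(\mathcal E)$ and let $s\in\mathcal E$ be such that $(\vartheta-\varrho)^\mu(s)\in x\mathcal E$ for a certain $\mu\in\mathbb N$. Then, for all $k\in\mathbb Z$, we have $$(\vartheta-(\varrho+k))^\mu(x^k\phi(s))\in x^{k+1}\phi(\mathcal E).$$ (2) Let $\delta$ be the largest integer in $\mathrm{Exp}(\mathcal F)\ominus\mathrm{Exp}(\mathcal E)$. Then $x^\delta\phi(\mathcal E)\subset\mathcal F$. In particular, there exists an arrow $\Phi:\mathcal E\to\mathcal F(\delta)$ of $\mathbf{MC}_{\log}(C[[x]]/C)$ such that $\gamma\Phi=\phi$. (3) Suppose that $\mathrm{Exp}(\mathcal F)\ominus\mathrm{Exp}(\mathcal E)$ contains no positive integer. Then the natural arrow $\mathrm{Hom}(\mathcal E,\mathcal F)\to\mathrm{Hom}(E,F)$ (from arrows of $\mathbf{MC}_{\log}(C[[x]]/C)$ to arrows of $\mathbf{MC}_{\rm rs}(C((x))/C)$) is bijective.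
   Context: $\vartheta=x\frac{d}{dx}$ on $C[[x]]$ and $C((x))$. $\mathbf{MC}(C((x))/C)$: pairs $(M,\nabla)$ with $M$ a finite-dimensional $C((x))$-space and $\nabla:M\to M$ a $C$-linear map with $\nabla(fm)=\vartheta(f)m+f\nabla(m)$; arrows are $C((x))$-linear maps commuting with $\nabla$. $\mathbf{MC}_{\log}(C[[x]]/C)$: the same with finitely generated $C[[x]]$-modules. $\gamma:\mathbf{MC}_{\log}(C[[x]]/C)\to\mathbf{MC}(C((x))/C)$ inverts $x$. $\mathbf{MC}_{\rm rs}(C((x))/C)$ is the full subcategory of objects $M$ isomorphic to some $\gamma(\mathcal M)$; such an $\mathcal M$ (with the isomorphism) is a logarithmic model of $M$, and a logarithmic lattice if it is moreover a free $C[[x]]$-module. For a model $\mathcal E$ of $E$, $\phi(s)$ for $s\in\mathcal E$ means $\phi$ applied to the image of $s$ in $E$, and a lattice $\mathcal F$ is regarded as contained in $F$. The residue of $(\mathcal M,\nabla)\in\mathbf{MC}_{\log}(C[[x]]/C)$ is the $C$-linear endomorphism of $\mathcal M/x\mathcal M$ induced by $\nabla$; $\mathrm{Exp}(\mathcal M)$ is its set of eigenvalues. For $A,B\subset C$, $A\ominus B=\{a-b: a\in A,b\in B\}$. For $\delta\in\mathbb Z$, $\mathbf 1(\delta)$ is the $C[[x]]$-submodule $x^{-\delta}C[[x]]$ of $C((x))$ with derivation $\vartheta$, and $\mathcal M(\delta)=\mathbf 1(\delta)\otimes_{C[[x]]}\mathcal M$ with the tensor product derivation. *)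

(* Defs.v *)
From HB Require Import structures.
From mathcomp Require Import all_boot all_order all_algebra.
From mathcomp Require Import ring_quotient generic_quotient.
From mathcomp Require Import ring zify.
From mathcomp Require Import boolp classical_sets.

Set Implicit Arguments.
Unset Strict Implicit.
Unset Printing Implicit Defensive.

Import GRing.Theory.
Local Open Scope ring_scope.
Local Open Scope quotient_scope.

Record fps (C : fieldType) := Fps { fcoef : nat -> C }.
Arguments Fps {C} _.

Lemma fpsP (C : fieldType) (f g : fps C) : (forall n, fcoef f n = fcoef g n) -> f = g.
Proof. by case: f g => f [g] /= fg; congr Fps; apply: funext. Qed.

HB.instance Definition _ (C : fieldType) := gen_eqMixin (fps C).
HB.instance Definition _ (C : fieldType) := gen_choiceMixin (fps C).

Section PowerSeries.
Variable C : fieldType.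
Implicit Types f g h : fps C.

Definition fps_zero : fps C := Fps (fun _ => 0).
Definition fps_add f g : fps C := Fps (fun n => fcoef f n + fcoef g n).
Definition fps_opp f : fps C := Fps (fun n => - fcoef f n).

Fact fps_addA : associative fps_add.
Proof. by move=> f g h; apply: fpsP => n /=; rewrite addrA. Qed.
Fact fps_addC : commutative fps_add.
Proof. by move=> f g; apply: fpsP => n /=; rewrite addrC. Qed.
Fact fps_add0 : left_id fps_zero fps_add.
Proof. by move=> f; apply: fpsP => n /=; rewrite add0r. Qed.
Fact fps_addN : left_inverse fps_zero fps_opp fps_add.
Proof. by move=> f; apply: fpsP => n /=; rewrite addNr. Qed.

HB.instance Definition _ :=
  GRing.isZmodule.Build (fps C) fps_addA fps_addC fps_add0 fps_addN.

Definition fpsC (c : C) : fps C := Fps (fun n => if n == 0%N then c else 0).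
Definition fpsX : fps C := Fps (fun n => (n == 1%N)%:R).
Definition fps_mul f g : fps C :=
  Fps (fun n => \sum_(i < n.+1) fcoef f i * fcoef g (n - i)%N).

Lemma fps_mulE f g n :
  fcoef (fps_mul f g) n = \sum_(i < n.+1) fcoef f i * fcoef g (n - i)%N.
Proof. by []. Qed.

Definition fps_trunc m f : {poly C} := \poly_(i < m.+1) fcoef f i.

Lemma fps_mul_trunc m n f g : (n <= m)%N ->
  fcoef (fps_mul f g) n = (fps_trunc m f * fps_trunc m g)`_n.
Proof.
move=> nm /=; rewrite coefM; apply: eq_bigr => i _; rewrite !coef_poly.
have im : (i < m.+1)%N by rewrite (leq_trans (ltn_ord i)).
by rewrite im ifT // ltnS (leq_trans (leq_subr _ _)).
Qed.

Fact fps_mulC : commutative fps_mul.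
Proof. by move=> f g; apply: fpsP => n; rewrite !(@fps_mul_trunc n) // mulrC. Qed.

Fact fps_mulA : associative fps_mul.
Proof.
move=> f g h; apply: fpsP => n.
have -> : fcoef (fps_mul f (fps_mul g h)) n =
    (fps_trunc n f * (fps_trunc n g * fps_trunc n h))`_n.
  rewrite coefM fps_mulE; apply: eq_bigr => i _.
  by rewrite [fcoef (fps_mul _ _) _](@fps_mul_trunc n) ?leq_subr // coef_poly ltn_ord.
have -> : fcoef (fps_mul (fps_mul f g) h) n =
    (fps_trunc n f * fps_trunc n g * fps_trunc n h)`_n.
  rewrite coefM fps_mulE; apply: eq_bigr => i _.
  rewrite [fcoef (fps_mul _ _) _](@fps_mul_trunc n) -1?ltnS //.
  by rewrite coef_poly ltnS leq_subr.
by rewrite mulrA.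
Qed.

Fact fps_mul1 : left_id (fpsC 1) fps_mul.
Proof.
move=> f; apply: fpsP => n /=; rewrite big_ord_recl /= mul1r subn0.
by rewrite big1 ?addr0 // => i _; rewrite mul0r.
Qed.

Fact fps_mulDl : left_distributive fps_mul +%R.
Proof.
move=> f g h; apply: fpsP => n /=; rewrite -big_split /=.
by apply: eq_bigr => i _; rewrite mulrDl.
Qed.

Fact fps_one_neq0 : fpsC 1 != 0.
Proof. by apply/eqP => /(congr1 (fun f => fcoef f 0)) /= /eqP; rewrite oner_eq0. Qed.

HB.instance Definition _ := GRing.Zmodule_isComNzRing.Build (fps C)
  fps_mulA fps_mulC fps_mul1 fps_mulDl fps_one_neq0.

Lemma fcoefD f g n : fcoef (f + g) n = fcoef f n + fcoef g n. Proof. by []. Qed.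
Lemma fcoefN f n : fcoef (- f) n = - fcoef f n. Proof. by []. Qed.
Lemma fcoef0 n : fcoef (0 : fps C) n = 0. Proof. by []. Qed.
Lemma fcoef1 n : fcoef (1 : fps C) n = (n == 0%N)%:R.
Proof. by rewrite /=; case: eqP. Qed.
Lemma fcoefM f g n :
  fcoef (f * g) n = \sum_(i < n.+1) fcoef f i * fcoef g (n - i)%N.
Proof. by []. Qed.

Fixpoint fps_inv_seq f n : seq C :=
  if n is m.+1 then
    let s := fps_inv_seq f m in
    rcons s ((fcoef f 0)^-1 *
             ((m == 0%N)%:R - \sum_(i < m) s`_i * fcoef f (m - i)%N))
  else [::].

Definition fps_unit : {pred fps C} := fun f => fcoef f 0 != 0.
Definition fps_inv f : fps C :=
  if fcoef f 0 != 0 then Fps (fun n => (fps_inv_seq f n.+1)`_n) else f.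

Lemma size_fps_inv_seq f n : size (fps_inv_seq f n) = n.
Proof. by elim: n => //= n IHn; rewrite size_rcons IHn. Qed.

Lemma nth_fps_inv_seq f n i : (i < n)%N ->
  (fps_inv_seq f n)`_i = (fps_inv_seq f i.+1)`_i.
Proof.
elim: n => // n IHn; rewrite ltnS leq_eqVlt => /orP[/eqP-> //|lt_in].
by rewrite -IHn //= nth_rcons size_fps_inv_seq lt_in.
Qed.

Fact fps_mulV : {in fps_unit, left_inverse 1 fps_inv *%R}.
Proof.
move=> f; rewrite unfold_in => f0; apply: fpsP => n.
rewrite fcoef1 fcoefM /fps_inv f0 big_ord_recr /= subnn.
rewrite nth_rcons size_fps_inv_seq ltnn eqxx mulrAC mulVf // mul1r.
rewrite addrC -addrA [X in _ + X]addrC -[RHS]addr0; congr (_ + _); apply/eqP.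
rewrite subr_eq0; apply/eqP; apply: eq_bigr => i _.
by rewrite (nth_fps_inv_seq _ (ltn_ord i)).
Qed.

Fact fps_unitPl f g : g * f = 1 -> f \in fps_unit.
Proof.
move=> /(congr1 (fun h => fcoef h 0)); rewrite fcoefM big_ord1 fcoef1 eqxx => gf.
rewrite unfold_in; apply/eqP => f0; move/eqP: gf.
by rewrite f0 mulr0 eq_sym oner_eq0.
Qed.

Fact fps_inv_out : {in [predC fps_unit], fps_inv =1 id}.
Proof. by move=> f; rewrite inE /fps_inv [f \in _]unfold_in => /negPf->. Qed.

HB.instance Definition _ := GRing.ComNzRing_hasMulInverse.Build (fps C)
  fps_mulV fps_unitPl fps_inv_out.

Lemma fps_ord f : f != 0 -> {n | fcoef f n != 0 & forall i, (i < n)%N -> fcoef f i = 0}.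
Proof.
move=> f0; have ex : exists n, fcoef f n != 0.
  apply: contrapT => all0; move/eqP: f0; apply; apply: fpsP => n.
  by apply/eqP/negPn/negP => fn; apply: all0; exists n.
exists (ex_minn ex); case: ex_minnP => // m _ le_m i lt_im.
by apply/eqP/negPn/negP => /le_m; rewrite leqNgt lt_im.
Qed.

Fact fps_mul_integral f g : f * g = 0 -> (f == 0) || (g == 0).
Proof.
move=> fg; apply/norP=> -[/fps_ord [m fm f_lt] /fps_ord [n gn g_lt]].
move/(congr1 (fun h => fcoef h (m + n))): fg.
have lt_m : (m < (m + n).+1)%N by rewrite ltnS leq_addr.
rewrite fcoefM fcoef0 (bigD1 (Ordinal lt_m)) //= addKn big1 => [|i].
  by move/eqP; rewrite addr0 mulf_eq0 (negPf fm) (negPf gn).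
rewrite -val_eqE /= neq_ltn => /orP[/f_lt -> |lt_mi]; first by rewrite mul0r.
by rewrite g_lt ?mulr0 //; have := ltn_ord i; lia.
Qed.

HB.instance Definition _ := GRing.ComUnitRing_isIntegral.Build (fps C) fps_mul_integral.

Fact fpsC_is_zmod_morphism : zmod_morphism fpsC.
Proof. by move=> a b; apply: fpsP => n /=; case: eqP; rewrite ?subrr. Qed.
Fact fpsC_is_monoid_morphism : monoid_morphism fpsC.
Proof.
split=> // a b; apply: fpsP => n; rewrite fcoefM big_ord_recl /= subn0.
rewrite big1 ?addr0; first by case: (n == 0%N); rewrite ?mulr0.
by move=> i _; rewrite mul0r.
Qed.
HB.instance Definition _ := GRing.isZmodMorphism.Build C (fps C) fpsC fpsC_is_zmod_morphism.
HB.instance Definition _ := GRing.isMonoidMorphism.Build C (fps C) fpsC fpsC_is_monoid_morphism.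

(* The derivation x d/dx *)
Definition theta f : fps C := Fps (fun n => fcoef f n *+ n).

Lemma thetaD f g : theta (f + g) = theta f + theta g.
Proof. by apply: fpsP => n /=; rewrite mulrnDl. Qed.
Lemma thetaM f g : theta (f * g) = theta f * g + f * theta g.
Proof.
apply: fpsP => n; rewrite fcoefD /= -sumrMnl -big_split /=.
apply: eq_bigr => i _; rewrite mulrnAl mulrnAr -mulrnDr subnKC //.
by rewrite -ltnS.
Qed.
Lemma theta_const c : theta (fpsC c) = 0.
Proof. by apply: fpsP => -[|n] /=; rewrite ?mul0rn. Qed.
Lemma thetaX : theta fpsX = fpsX.
Proof. by apply: fpsP => -[|[|n]] //=; rewrite mul0rn. Qed.

End PowerSeries.
Arguments fpsX {C}.

Definition laurent (C : fieldType) : Type := {fraction (fps C)}.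
HB.instance Definition _ (C : fieldType) := GRing.Field.on (laurent C).

Section Laurent.
Variable C : fieldType.
Implicit Types (f g : fps C) (a b : laurent C).

Definition fps_laurent (f : fps C) : laurent C := FracField.tofrac f.
HB.instance Definition _ := GRing.RMorphism.copy fps_laurent (@FracField.tofrac (fps C)).

Definition laurentC (c : C) : laurent C := fps_laurent (fpsC c).
HB.instance Definition _ := GRing.RMorphism.copy laurentC (fps_laurent \o @fpsC C).

Definition laurentX : laurent C := fps_laurent fpsX.

Lemma fps_laurentD f g : fps_laurent (f + g) = fps_laurent f + fps_laurent g.
Proof. exact: rmorphD. Qed.
Lemma fps_laurentB f g : fps_laurent (f - g) = fps_laurent f - fps_laurent g.
Proof. exact: rmorphB. Qed.
Lemma fps_laurentM f g : fps_laurent (f * g) = fps_laurent f * fps_laurent g.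
Proof. exact: rmorphM. Qed.
Lemma fps_laurentXn f n : fps_laurent (f ^+ n) = fps_laurent f ^+ n.
Proof. exact: rmorphXn. Qed.
Lemma fps_laurent1 : fps_laurent 1 = 1.
Proof. exact: rmorph1. Qed.
Lemma fps_laurent_eq0 f : (fps_laurent f == 0) = (f == 0).
Proof. exact: tofrac_eq0. Qed.

Lemma fpsX_neq0 : (fpsX : fps C) != 0.
Proof. by apply/eqP => /(congr1 (fun f => fcoef f 1)) /= /eqP; rewrite oner_eq0. Qed.
Lemma laurentX_neq0 : laurentX != 0.
Proof. by rewrite fps_laurent_eq0 fpsX_neq0. Qed.

Definition lnum a : fps C := \n_(repr (a : {fraction (fps C)})).
Definition lden a : fps C := \d_(repr (a : {fraction (fps C)})).

Lemma lden_neq0 a : lden a != 0. Proof. exact: denom_ratioP. Qed.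

Lemma lnumden a : a = fps_laurent (lnum a) / fps_laurent (lden a).
Proof.
apply: canRL (mulfK _) _; first by rewrite fps_laurent_eq0 lden_neq0.
rewrite /lnum /lden /fps_laurent -[a in LHS]reprK.
unlock FracField.tofrac; rewrite -[LHS]FracField.pi_mul; apply/eqmodP => /=.
rewrite FracField.equivfE /FracField.mulf !numden_Ratio ?oner_neq0 //.
  by rewrite reprK !mulr1 mulrC.
all: by rewrite mulr1 denom_ratioP.
Qed.

(* Extension of theta to C((x)) by the quotient rule *)
Definition thetaL a : laurent C :=
  fps_laurent (theta (lnum a) * lden a - lnum a * theta (lden a))
    / fps_laurent (lden a) ^+ 2.

Lemma thetaL_frac f g : g != 0 ->
  thetaL (fps_laurent f / fps_laurent g) =
  fps_laurent (theta f * g - f * theta g) / fps_laurent g ^+ 2.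
Proof.
move=> g0; set a := _ / _; rewrite /thetaL.
have := lnumden a; have := lden_neq0 a.
move: (lnum a) (lden a) => n d d0; rewrite {}/a => e.
have g0' : fps_laurent g != 0 by rewrite fps_laurent_eq0.
have d0' : fps_laurent d != 0 by rewrite fps_laurent_eq0.
have {}e : f * d = n * g.
  apply/eqP; rewrite -[_ == _](tofrac_eq (f * d)) !rmorphM /=.
  by rewrite -eqr_div //; apply/eqP.
have e' : theta f * d + f * theta d = theta n * g + n * theta g by rewrite -!thetaM e.
have key : (theta n * d - n * theta d) * g ^+ 2 = (theta f * g - f * theta g) * d ^+ 2.
  have -> : (theta n * d - n * theta d) * g ^+ 2 =
      (theta n * g + n * theta g) * g * d - (n * g) * (theta g * d + theta d * g) by ring.
  rewrite -e -e'; ring.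
apply/eqP; rewrite eqr_div ?expf_neq0 //; apply/eqP.
by move/(congr1 (fun h => fps_laurent h)): key; rewrite !(fps_laurentM, fps_laurentXn).
Qed.

End Laurent.
Arguments laurentX C : clear implicits.

Section LaurentDerivation.
Variable C : fieldType.
Implicit Types (f g : fps C) (a b : laurent C).

Fact quotD (K : fieldType) (n d m e n' d' m' e' : K) : d != 0 -> e != 0 ->
  ((n' * e + n * e' + (m' * d + m * d')) * (d * e)
     - (n * e + m * d) * (d' * e + d * e')) / (d * e) ^+ 2 =
  (n' * d - n * d') / d ^+ 2 + (m' * e - m * e') / e ^+ 2.
Proof. by move=> d0 e0; field; rewrite d0 e0. Qed.

Fact quotM (K : fieldType) (n d m e n' d' m' e' : K) : d != 0 -> e != 0 ->
  ((n' * m + n * m') * (d * e) - (n * m) * (d' * e + d * e')) / (d * e) ^+ 2 =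
  (n' * d - n * d') / d ^+ 2 * (m / e) + n / d * ((m' * e - m * e') / e ^+ 2).
Proof. by move=> d0 e0; field; rewrite d0 e0. Qed.

Fact derivV (K : fieldType) (n u v : K) : u != 0 -> n * u / u + u * v = 0 -> v = - n * u^-1.
Proof.
move=> u0; rewrite mulfK // => /(canRL (addKr _)); rewrite addr0 => e.
by apply: (mulfI u0); rewrite e mulrCA divff // mulr1.
Qed.

Lemma thetaL_fps f : thetaL (fps_laurent f) = fps_laurent (theta f).
Proof.
have := thetaL_frac f (oner_neq0 (fps C)).
have t1 : theta (1 : fps C) = 0 := theta_const 1.
by rewrite t1 mulr0 subr0 mulr1 fps_laurent1 expr1n !divr1.
Qed.

Lemma thetaLD a b : thetaL (a + b) = thetaL a + thetaL b.
Proof.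
rewrite [a]lnumden [b]lnumden.
move: (lden_neq0 a) (lden_neq0 b).
move: (lnum a) (lden a) (lnum b) (lden b) => n d m e d0 e0.
have d1 : fps_laurent d != 0 by rewrite fps_laurent_eq0.
have e1 : fps_laurent e != 0 by rewrite fps_laurent_eq0.
have -> : fps_laurent n / fps_laurent d + fps_laurent m / fps_laurent e =
    fps_laurent (n * e + m * d) / fps_laurent (d * e).
  by rewrite fps_laurentD !fps_laurentM (addf_div _ _ d1 e1).
rewrite !thetaL_frac ?mulf_neq0 // !(thetaD, thetaM).
rewrite !(fps_laurentB, fps_laurentD, fps_laurentM); apply: (quotD _ _ _ _ _ _ d1 e1).
Qed.

Lemma thetaLM a b : thetaL (a * b) = thetaL a * b + a * thetaL b.
Proof.
rewrite [a]lnumden [b]lnumden.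
move: (lden_neq0 a) (lden_neq0 b).
move: (lnum a) (lden a) (lnum b) (lden b) => n d m e d0 e0.
have d1 : fps_laurent d != 0 by rewrite fps_laurent_eq0.
have e1 : fps_laurent e != 0 by rewrite fps_laurent_eq0.
have -> : fps_laurent n / fps_laurent d * (fps_laurent m / fps_laurent e) =
    fps_laurent (n * m) / fps_laurent (d * e).
  by rewrite !fps_laurentM mulf_div.
rewrite !thetaL_frac ?mulf_neq0 // !thetaM.
rewrite !(fps_laurentB, fps_laurentD, fps_laurentM); apply: (quotM _ _ _ _ _ _ d1 e1).
Qed.

Lemma thetaL_const (c : C) : thetaL (laurentC c) = 0.
Proof. by rewrite thetaL_fps theta_const; exact: (raddf0 (@fps_laurent C)). Qed.

Lemma thetaL_X (k : int) : thetaL (laurentX C ^ k) = k%:~R * laurentX C ^ k :> laurent C.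
Proof.
have X0 := laurentX_neq0 C.
have tX : thetaL (laurentX C) = laurentX C by rewrite thetaL_fps thetaX.
have t1 : thetaL (1 : laurent C) = 0.
  exact: (etrans (congr1 (@thetaL C) (esym (fps_laurent1 C))) (thetaL_const 1)).
have posX (n : nat) : thetaL (laurentX C ^+ n) = n%:R * laurentX C ^+ n.
  elim: n => [|n IHn]; first by rewrite expr0 t1 mul0r.
  by rewrite exprS thetaLM tX IHn mulrS; ring.
case: k => n; first exact: posX.
rewrite NegzE -exprnN rmorphN /=.
have Xn0 : laurentX C ^+ n.+1 != 0 by rewrite expf_neq0.
have e : n.+1%:R * laurentX C ^+ n.+1 / laurentX C ^+ n.+1
    + laurentX C ^+ n.+1 * thetaL (laurentX C ^- n.+1) = 0.
  by rewrite -posX -thetaLM divff.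
exact: (derivV Xn0 e).
Qed.

Definition laurent_scale f a : laurent C := fps_laurent f * a.
Fact laurent_scaleA f g a : laurent_scale f (laurent_scale g a) = laurent_scale (f * g) a.
Proof. by rewrite /laurent_scale mulrA -rmorphM. Qed.
Fact laurent_scale1 : left_id 1 laurent_scale.
Proof. by move=> a; rewrite /laurent_scale rmorph1 mul1r. Qed.
Fact laurent_scaleDr : right_distributive laurent_scale +%R.
Proof. by move=> f a b; rewrite /laurent_scale mulrDr. Qed.
Fact laurent_scaleDl a : {morph laurent_scale^~ a : f g / f + g}.
Proof. by move=> f g; rewrite /laurent_scale rmorphD mulrDl. Qed.
HB.instance Definition _ := GRing.Zmodule_isLmodule.Build (fps C) (laurent C)
  laurent_scaleA laurent_scale1 laurent_scaleDr laurent_scaleDl.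

Lemma laurent_scaleE f a : f *: a = fps_laurent f * a. Proof. by []. Qed.

End LaurentDerivation.

Section Tensor.
Variable R : comNzRingType.

Definition balanced (M N : lmodType R) (L : zmodType) (b : M -> N -> L) : Prop :=
  [/\ forall m m' n, b (m + m') n = b m n + b m' n,
      forall m n n', b m (n + n') = b m n + b m n' &
      forall r m n, b (r *: m) n = b m (r *: n)].

Variables M N : lmodType R.
Implicit Types s t : seq (M * N).

(* A list represents the formal sum of the pure tensors of its entries; two
   formal sums agree in the tensor product when no balanced map separates
   them. *)
Definition tens_eq s t : bool :=
  `[< forall (L : zmodType) (b : M -> N -> L), balanced b ->
      \sum_(p <- s) b p.1 p.2 = \sum_(p <- t) b p.1 p.2 >].

Fact tens_eq_refl : reflexive tens_eq.
Proof. by move=> s; apply/asboolP. Qed.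
Fact tens_eq_sym : symmetric tens_eq.
Proof. by move=> s t; apply/asboolP/asboolP => st L b bb; rewrite st. Qed.
Fact tens_eq_trans : transitive tens_eq.
Proof.
move=> s r t /asboolP rs /asboolP st; apply/asboolP => L b bb.
by rewrite rs // st.
Qed.
Canonical tens_eq_equiv := EquivRel tens_eq tens_eq_refl tens_eq_sym tens_eq_trans.

Definition tensor : Type := {eq_quot tens_eq}.
HB.instance Definition _ : EqQuotient _ tens_eq tensor := EqQuotient.on tensor.
HB.instance Definition _ := Choice.on tensor.

Definition tens_cls s : tensor := \pi_tensor s.
Definition tens (m : M) (n : N) : tensor := tens_cls [:: (m, n)].

Lemma tens_clsP s t :
  (forall (L : zmodType) (b : M -> N -> L), balanced b ->
      \sum_(p <- s) b p.1 p.2 = \sum_(p <- t) b p.1 p.2) ->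
  tens_cls s = tens_cls t.
Proof. by move=> st; apply/eqmodP/asboolP. Qed.

Lemma tens_clsK (L : zmodType) (b : M -> N -> L) s : balanced b ->
  \sum_(p <- repr (tens_cls s)) b p.1 p.2 = \sum_(p <- s) b p.1 p.2.
Proof.
move=> bb; have /eqmodP/asboolP -> // : repr (tens_cls s) = s %[mod tensor].
exact: reprK.
Qed.

Lemma tens_cls_ind (P : tensor -> Prop) : (forall s, P (tens_cls s)) -> forall u, P u.
Proof. by move=> Ps u; rewrite -[u]reprK; apply: Ps. Qed.

Definition tens_add (u v : tensor) : tensor := tens_cls (repr u ++ repr v).
Definition tens_opp (u : tensor) : tensor := tens_cls [seq (- p.1, p.2) | p <- repr u].
Definition tens_zero : tensor := tens_cls [::].

Lemma balancedNl (L : zmodType) (b : M -> N -> L) : balanced b ->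
  forall m n, b (- m) n = - b m n.
Proof.
move=> [bDl _ _] m n; apply: (addIr (b m n)); rewrite -bDl !addNr.
by apply: (addIr (b 0 n)); rewrite -bDl !add0r.
Qed.

Lemma tens_addE s t : tens_add (tens_cls s) (tens_cls t) = tens_cls (s ++ t).
Proof. by apply: tens_clsP => L b bb; rewrite !big_cat /= !tens_clsK. Qed.

Fact tens_addA : associative tens_add.
Proof.
elim/tens_cls_ind=> s; elim/tens_cls_ind=> t; elim/tens_cls_ind=> r.
by rewrite !tens_addE catA.
Qed.
Fact tens_addC : commutative tens_add.
Proof.
elim/tens_cls_ind=> s; elim/tens_cls_ind=> t; rewrite !tens_addE.
by apply: tens_clsP => L b bb; rewrite !big_cat /= addrC.
Qed.
Fact tens_add0 : left_id tens_zero tens_add.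
Proof. by elim/tens_cls_ind=> s; rewrite tens_addE. Qed.
Fact tens_addN : left_inverse tens_zero tens_opp tens_add.
Proof.
elim/tens_cls_ind=> s; rewrite tens_addE; apply: tens_clsP => L b bb.
rewrite big_cat big_map big_nil /= -[RHS](addNr (\sum_(p <- s) b p.1 p.2)).
rewrite -(tens_clsK s bb) -sumrN; congr (_ + _).
by apply: eq_bigr => p _; rewrite balancedNl.
Qed.
HB.instance Definition _ :=
  GRing.isZmodule.Build tensor tens_addA tens_addC tens_add0 tens_addN.

Lemma tens_balanced : balanced tens.
Proof.
split=> [m m' n|m n n'|r m n].
- apply: etrans _ (esym (tens_addE _ _)); apply: tens_clsP => L b [bDl _ _].
  by rewrite !big_cons !big_nil /= !addr0 bDl.
- apply: etrans _ (esym (tens_addE _ _)); apply: tens_clsP => L b [_ bDr _].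
  by rewrite !big_cons !big_nil /= !addr0 bDr.
- apply: tens_clsP => L b [_ _ bZ].
  by rewrite !big_cons !big_nil /= !addr0 bZ.
Qed.

Lemma tens_cls_sum s : tens_cls s = \sum_(p <- s) tens p.1 p.2.
Proof.
elim: s => [|[m n] s IHs]; first by rewrite big_nil.
by rewrite big_cons -IHs; exact: (esym (tens_addE [:: (m, n)] s)).
Qed.

Lemma tens_ind (P : tensor -> Prop) : P 0 -> (forall m n, P (tens m n)) ->
  (forall u v, P u -> P v -> P (u + v)) -> forall u, P u.
Proof.
move=> P0 Pt PD; elim/tens_cls_ind=> s; rewrite tens_cls_sum.
by elim/big_ind: _.
Qed.

Definition tens_lift (L : zmodType) (b : M -> N -> L) (u : tensor) : L :=
  \sum_(p <- repr u) b p.1 p.2.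

Lemma tens_liftE (L : zmodType) (b : M -> N -> L) m n : balanced b ->
  tens_lift b (tens m n) = b m n.
Proof. by move=> bb; rewrite /tens_lift tens_clsK // big_seq1. Qed.

Lemma tens_liftD (L : zmodType) (b : M -> N -> L) u v : balanced b ->
  tens_lift b (u + v) = tens_lift b u + tens_lift b v.
Proof. by move=> bb; rewrite /tens_lift tens_clsK // big_cat. Qed.

Lemma tens_lift0 (L : zmodType) (b : M -> N -> L) : balanced b -> tens_lift b 0 = 0.
Proof. by move=> bb; apply: (addIr (tens_lift b 0)); rewrite -tens_liftD // !add0r. Qed.

Lemma tens_lift_eq (L : zmodType) (f g : tensor -> L) :
  {morph f : u v / u + v} -> {morph g : u v / u + v} ->
  (forall m n, f (tens m n) = g (tens m n)) -> f =1 g.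
Proof.
move=> fD gD fg; elim/tens_ind => // [|u v IHu IHv]; last by rewrite fD gD IHu IHv.
by apply: (addIr (f 0)); rewrite -fD add0r; apply: (addIr (g 0));
   rewrite -addrA [f 0 + _]addrC addrA -gD !add0r addrC.
Qed.

Lemma tens0r m : tens m 0 = 0.
Proof. by have [_ tD _] := tens_balanced; apply: (addIr (tens m 0)); rewrite -tD !add0r. Qed.
Lemma tens0l n : tens 0 n = 0.
Proof. by have [tD _ _] := tens_balanced; apply: (addIr (tens 0 n)); rewrite -tD !add0r. Qed.

Lemma tens_suml I (r : seq I) (F : I -> M) n :
  tens (\sum_(i <- r) F i) n = \sum_(i <- r) tens (F i) n.
Proof.
have [tD _ _] := tens_balanced.
by elim: r => [|i r IHr]; rewrite ?big_nil ?tens0l // !big_cons tD IHr.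
Qed.
Lemma tens_sumr I (r : seq I) (F : I -> N) m :
  tens m (\sum_(i <- r) F i) = \sum_(i <- r) tens m (F i).
Proof.
have [_ tD _] := tens_balanced.
by elim: r => [|i r IHr]; rewrite ?big_nil ?tens0r // !big_cons tD IHr.
Qed.

Definition tens_lact (a : M -> M) : tensor -> tensor :=
  tens_lift (fun m n => tens (a m) n).

Lemma tens_lact_balanced (a : M -> M) : {morph a : m m' / m + m'} ->
  (forall r m, a (r *: m) = r *: a m) -> balanced (fun m n => tens (a m) n).
Proof.
have [tDl tDr tZ] := tens_balanced.
by move=> aD aZ; split=> [m m' n|m n n'|r m n]; rewrite ?aD ?aZ // ?tZ.
Qed.

Definition tens_scale (r : R) : tensor -> tensor := tens_lact (fun m => r *: m).

Fact tens_scale_balanced r : balanced (fun m n => tens (r *: m) n).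
Proof.
apply: (@tens_lact_balanced ( *:%R r)) => [m m'|c m]; first by rewrite scalerDr.
by rewrite !scalerA mulrC.
Qed.
Fact tens_scaleDr : right_distributive tens_scale +%R.
Proof. by move=> r u v; rewrite [LHS]tens_liftD //; exact: tens_scale_balanced. Qed.
Fact tens_scale_tens r m n : tens_scale r (tens m n) = tens (r *: m) n.
Proof. exact: tens_liftE (tens_scale_balanced r). Qed.
Fact tens_scaleA r c u : tens_scale r (tens_scale c u) = tens_scale (r * c) u.
Proof.
move: u; apply: tens_lift_eq => [u v|u v|m n]; rewrite ?tens_scaleDr //.
by rewrite !tens_scale_tens scalerA.
Qed.
Fact tens_scale1 : left_id 1 tens_scale.
Proof.
apply: tens_lift_eq => [u v|//|m n]; first by rewrite tens_scaleDr.
by rewrite tens_scale_tens scale1r.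
Qed.
Fact tens_scaleDl u : {morph tens_scale^~ u : r c / r + c}.
Proof.
move=> r c; move: u; have [tD _ _] := tens_balanced.
apply: tens_lift_eq => [u v|u v|m n]; rewrite ?tens_scaleDr //; first by rewrite addrACA.
by rewrite !tens_scale_tens scalerDl tD.
Qed.
HB.instance Definition _ := GRing.Zmodule_isLmodule.Build R tensor
  tens_scaleA tens_scale1 tens_scaleDr tens_scaleDl.

Definition tens_nabla (dM : M -> M) (dN : N -> N) : tensor -> tensor :=
  tens_lift (fun m n => tens (dM m) n + tens m (dN n)).

Variables (theta : R -> R) (dM : M -> M) (dN : N -> N).
Hypotheses (dMD : {morph dM : m m' / m + m'}) (dND : {morph dN : n n' / n + n'}).
Hypotheses (dML : forall r m, dM (r *: m) = theta r *: m + r *: dM m)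
           (dNL : forall r n, dN (r *: n) = theta r *: n + r *: dN n).

Lemma tens_nabla_balanced : balanced (fun m n => tens (dM m) n + tens m (dN n)).
Proof.
have [tDl tDr tZ] := tens_balanced; split=> [m m' n|m n n'|r m n].
- by rewrite dMD !tDl addrACA.
- by rewrite dND !tDr addrACA.
- by rewrite dML dNL tDl tDr !tZ -addrA addrCA addrA.
Qed.

Lemma tens_nablaD : {morph tens_nabla dM dN : u v / u + v}.
Proof. by move=> u v; rewrite /tens_nabla tens_liftD //; exact: tens_nabla_balanced. Qed.
Lemma tens_nablaE m n : tens_nabla dM dN (tens m n) = tens (dM m) n + tens m (dN n).
Proof. exact: tens_liftE tens_nabla_balanced. Qed.
Lemma tens_nabla_leibniz r u :
  tens_nabla dM dN (r *: u) = theta r *: u + r *: tens_nabla dM dN u.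
Proof.
move: u; have [tDl tDr tZ] := tens_balanced.
apply: tens_lift_eq => [u v|u v|m n].
- by rewrite scalerDr tens_nablaD.
- by rewrite tens_nablaD !scalerDr addrACA.
have sE c m' n' : c *: tens m' n' = tens (c *: m') n' by exact: tens_scale_tens.
by rewrite sE !tens_nablaE scalerDr !sE dML tDl addrA.
Qed.

End Tensor.

Section TensorMap.
Variables (R : comNzRingType) (M N P : lmodType R).

Definition tens_map (f : N -> P) : tensor M N -> tensor M P :=
  tens_lift (fun m n => tens m (f n)).

Lemma tens_map_balanced (f : {linear N -> P}) : balanced (fun (m : M) n => tens m (f n)).
Proof.
have [tDl tDr tZ] := tens_balanced M P.
by split=> [m m' n|m n n'|r m n]; rewrite ?linearD ?linearZ // ?tZ.
Qed.
Lemma tens_mapD (f : {linear N -> P}) : {morph tens_map f : u v / u + v}.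
Proof. by move=> u v; apply: tens_liftD; exact: tens_map_balanced. Qed.
Lemma tens_mapE (f : {linear N -> P}) m n : tens_map f (tens m n) = tens m (f n).
Proof. exact: tens_liftE (tens_map_balanced f). Qed.
End TensorMap.

Definition fin_gen (R : comNzRingType) (M : lmodType R) : Prop :=
  exists n (g : 'I_n -> M), forall m, exists c : 'I_n -> R, m = \sum_i c i *: g i.

(* Meant for finitely generated modules, where a basis is necessarily finite *)
Definition free_mod (R : comNzRingType) (M : lmodType R) : Prop :=
  exists n (g : 'I_n -> M), forall m, exists! c : {ffun 'I_n -> R}, m = \sum_i c i *: g i.

(* [R] is a C-algebra with structure map [iota], and [theta] a derivation of
   [R]; the cases used are C[[x]] and C((x)). *)
Section Connections.
Variables (C : fieldType) (R : comNzRingType).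
Variables (iota : {rmorphism C -> R}) (theta : R -> R).

Record conn := Conn {
  conn_mod :> lmodType R;
  nabla : conn_mod -> conn_mod;
  nabla_linear : forall c m n, nabla (iota c *: m + n) = iota c *: nabla m + nabla n;
  nabla_leibniz : forall f m, nabla (f *: m) = theta f *: m + f *: nabla m;
  conn_fin_gen : fin_gen conn_mod
}.

Record conn_hom (M N : conn) := ConnHom {
  hom_fun :> {linear M -> N};
  hom_nabla : forall m, hom_fun (nabla m) = nabla (hom_fun m)
}.

Record conn_iso (M N : conn) := ConnIso {
  iso_hom :> conn_hom M N;
  iso_inv : conn_hom N M;
  iso_homK : cancel iso_hom iso_inv;
  iso_invK : cancel iso_inv iso_hom
}.

Definition shift (M : conn) (rho : C) (m : M) : M := nabla m - iota rho *: m.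

Lemma nablaD (M : conn) : {morph @nabla M : m n / m + n}.
Proof. by move=> m n; have := nabla_linear 1 m n; rewrite rmorph1 !scale1r. Qed.

Lemma homP (M N : conn) (f g : conn_hom M N) : f =1 g -> f = g.
Proof.
case: f g => [f f_nabla] [g g_nabla] /= fg.
have e : f = g.
  case: f g fg {f_nabla g_nabla} => [f cf] [g cg] /= fg.
  have e : f = g by apply: funext.
  case: _ / e cg {fg} => cg; congr GRing.Linear.Pack.
  case: cf cg => [[a1] [a2]] [[b1] [b2]].
  by rewrite (Prop_irrelevance a1 b1) (Prop_irrelevance a2 b2).
by case: _ / e g_nabla => g_nabla; congr ConnHom; apply: Prop_irrelevance.
Qed.

Section Composition.
Variables (M N P : conn).

Fact hom_comp_nabla (g : conn_hom N P) (f : conn_hom M N) m : (g \o f) (nabla m) = nabla ((g \o f) m).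
Proof. by rewrite /= !hom_nabla. Qed.
Definition hom_comp (g : conn_hom N P) (f : conn_hom M N) : conn_hom M P := ConnHom (hom_comp_nabla g f).

End Composition.

Definition iso_comp (M N P : conn) (g : conn_iso N P) (f : conn_iso M N) : conn_iso M P :=
  @ConnIso M P (hom_comp g f) (hom_comp (iso_inv f) (iso_inv g))
    (can_comp (iso_homK g) (iso_homK f)) (can_comp (iso_invK f) (iso_invK g)).

End Connections.

Arguments nabla {C R iota theta M} _ : rename.
Arguments shift {C R iota theta M} _ _.

Definition MC (C : fieldType) := conn (@laurentC C) (@thetaL C).
Definition MClog (C : fieldType) := conn (@fpsC C) (@theta C).
Identity Coercion MC_conn : MC >-> conn.
Identity Coercion MClog_conn : MClog >-> conn.

(* C((x)) = C[[x]][1/x], so inverting x in M is the base change C((x)) (x) M;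
   C((x)) acts on the left factor. *)
Section Localization.
Variables (C : fieldType) (M : lmodType (fps C)).

Definition locx : Type := tensor (laurent C) M.
HB.instance Definition _ := GRing.Zmodule.on locx.

Definition locx_scale (a : laurent C) : locx -> locx := tens_lact (fun b => a * b).

Lemma locx_scale_balanced (a : laurent C) :
  balanced (fun (b : laurent C) (m : M) => tens (a * b) m).
Proof.
apply: (@tens_lact_balanced _ (laurent C) M (fun b => a * b)) => [b b'|f b].
  by rewrite mulrDr.
by rewrite !laurent_scaleE mulrCA.
Qed.
Fact locx_scale_tens a b (m : M) : locx_scale a (tens b m) = tens (a * b) m.
Proof. exact: tens_liftE (locx_scale_balanced a). Qed.
Fact locx_scaleDr : right_distributive locx_scale +%R.
Proof. by move=> a u v; apply: tens_liftD; exact: locx_scale_balanced. Qed.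
Fact locx_scaleA a b u : locx_scale a (locx_scale b u) = locx_scale (a * b) u.
Proof.
move: u; apply: tens_lift_eq => [u v|u v|c m].
- by rewrite (locx_scaleDr b) locx_scaleDr.
- by rewrite locx_scaleDr.
- by rewrite !locx_scale_tens mulrA.
Qed.
Fact locx_scale1 : left_id 1 locx_scale.
Proof.
apply: tens_lift_eq => [u v|//|c m]; first by rewrite locx_scaleDr.
by rewrite locx_scale_tens mul1r.
Qed.
Fact locx_scaleDl u : {morph locx_scale^~ u : a b / a + b}.
Proof.
move=> a b; move: u; have [tD _ _] := tens_balanced (laurent C) M.
apply: tens_lift_eq => [u v|u v|c m].
- by rewrite locx_scaleDr.
- by rewrite !locx_scaleDr addrACA.
- by rewrite !locx_scale_tens mulrDl tD.
Qed.
HB.instance Definition _ := GRing.Zmodule_isLmodule.Build (laurent C) locx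
  locx_scaleA locx_scale1 locx_scaleDr locx_scaleDl.

Lemma locx_scaleE a b (m : M) : a *: (tens b m : locx) = tens (a * b) m.
Proof. exact: locx_scale_tens. Qed.

Lemma locx_fin_gen : fin_gen M -> fin_gen locx.
Proof.
case=> n [g g_gen]; exists n, (fun i => tens (1 : laurent C) (g i) : locx); apply: tens_ind.
- by exists (fun=> 0); rewrite big1 // => i _; rewrite scale0r.
- move=> a m; have [c ->] := g_gen m; exists (fun i => a * fps_laurent (c i)).
  rewrite tens_sumr; apply: eq_bigr => i _.
  have [_ _ tZ] := tens_balanced (laurent C) M.
  by rewrite locx_scaleE mulr1 -tZ laurent_scaleE mulrC.
- move=> u v [c ->] [d ->]; exists (fun i => c i + d i).
  by rewrite -big_split /=; apply: eq_bigr => i _; rewrite scalerDl.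
Qed.

End Localization.

Section Gamma.
Variables (C : fieldType).
Implicit Types M N : MClog C.

Definition gamma_nabla M : locx M -> locx M := tens_nabla (@thetaL C) nabla.

Fact thetaL_scale (f : fps C) (a : laurent C) :
  thetaL (f *: a) = theta f *: a + f *: thetaL a.
Proof. by rewrite !laurent_scaleE thetaLM thetaL_fps. Qed.

Lemma gamma_nablaD M : {morph @gamma_nabla M : u v / u + v}.
Proof.
exact: (tens_nablaD (@thetaLD C) (@nablaD _ _ _ _ M) thetaL_scale (@nabla_leibniz _ _ _ _ M)).
Qed.
Lemma gamma_nablaE M a (m : M) :
  gamma_nabla (tens a m) = tens (thetaL a) m + tens a (nabla m).
Proof.
exact: (tens_nablaE (@thetaLD C) (@nablaD _ _ _ _ M) thetaL_scale (@nabla_leibniz _ _ _ _ M)).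
Qed.
Fact gamma_nabla_leibniz M a (u : locx M) :
  gamma_nabla (a *: u) = thetaL a *: u + a *: gamma_nabla u.
Proof.
move: u; have [tD _ _] := tens_balanced (laurent C) M.
apply: tens_lift_eq => [u v|u v|b m].
- by rewrite scalerDr gamma_nablaD.
- by rewrite gamma_nablaD !scalerDr addrACA.
- by rewrite locx_scaleE !gamma_nablaE scalerDr !locx_scaleE thetaLM tD addrA.
Qed.
Fact gamma_nabla_linear M c (u v : locx M) :
  gamma_nabla (laurentC c *: u + v) = laurentC c *: gamma_nabla u + gamma_nabla v.
Proof. by rewrite gamma_nablaD gamma_nabla_leibniz thetaL_const scale0r add0r. Qed.

Definition gamma M : MC C :=
  @Conn C (laurent C) (@laurentC C) (@thetaL C) (locx M) (@gamma_nabla M)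
    (@gamma_nabla_linear M) (@gamma_nabla_leibniz M) (locx_fin_gen (conn_fin_gen M)).

Definition gamma_fun M N (f : conn_hom M N) : locx M -> locx N := @tens_map _ (laurent C) M N f.

Fact gamma_fun_linear M N (f : conn_hom M N) : linear (gamma_fun f).
Proof.
move=> a u v; rewrite /gamma_fun tens_mapD; congr (_ + _); move: u.
apply: tens_lift_eq => [u w|u w|b m].
- by rewrite scalerDr tens_mapD.
- by rewrite tens_mapD scalerDr.
- by rewrite locx_scaleE !tens_mapE locx_scaleE.
Qed.
HB.instance Definition _ M N (f : conn_hom M N) :=
  GRing.isLinear.Build (laurent C) (locx M) (locx N) *:%R (gamma_fun f) (gamma_fun_linear f).

Lemma gamma_funE M N (f : conn_hom M N) a (m : M) : gamma_fun f (tens a m) = tens a (f m).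
Proof. exact: tens_mapE. Qed.

Fact gamma_hom_nabla M N (f : conn_hom M N) (u : gamma M) :
  gamma_fun f (nabla u) = nabla (gamma_fun f u : gamma N).
Proof.
move: u; apply: tens_lift_eq => [u v|u v|b m].
- by rewrite [nabla _]gamma_nablaD linearD.
- by rewrite linearD [LHS]gamma_nablaD.
- have -> : nabla (tens b m : gamma M) = tens (thetaL b) m + tens b (nabla m).
    exact: gamma_nablaE.
  rewrite (linearD (gamma_fun f)) /= !gamma_funE hom_nabla.
  exact: (esym (gamma_nablaE b (f m))).
Qed.

Definition gamma_hom M N (f : conn_hom M N) : conn_hom (gamma M) (gamma N) :=
  @ConnHom _ _ _ _ (gamma M) (gamma N) (gamma_fun f) (gamma_hom_nabla f).

End Gamma.

Section Fiber.
Variables (C : fieldType) (M : lmodType (fps C)).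

Definition xsub : {pred M} := fun m => `[< exists n, m = fpsX *: n >].

Fact xsub_closed : zmod_closed xsub.
Proof.
split; first by apply/asboolP; exists 0; rewrite scaler0.
by move=> _ _ /asboolP[m ->] /asboolP[n ->]; apply/asboolP; exists (m - n); rewrite scalerBr.
Qed.
HB.instance Definition _ := GRing.isZmodClosed.Build M xsub xsub_closed.

Definition fiber : Type := Quotient.quot xsub.
HB.instance Definition _ := GRing.Zmodule.on fiber.

Definition fiber_pi (m : M) : fiber := \pi_(Quotient.quot xsub) m.

Lemma fiber_piP m n : fiber_pi m = fiber_pi n <-> exists p, m - n = fpsX *: p.
Proof.
split=> [/eqP|mn]; last by apply/eqP; rewrite -Quotient.idealrBE; apply/asboolP.
by rewrite -[_ == _]Quotient.idealrBE => /asboolP.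
Qed.

Lemma fiber_piD : {morph fiber_pi : m n / m + n}.
Proof. by move=> m n; rewrite /fiber_pi -[RHS]Quotient.pi_add. Qed.

Lemma fiber_piK (v : fiber) : fiber_pi (repr v) = v.
Proof. exact: reprK. Qed.

Lemma repr_fiber_pi m : exists p, repr (fiber_pi m) - m = fpsX *: p.
Proof. by apply/fiber_piP; rewrite fiber_piK. Qed.

Definition fiber_scale (c : C) (v : fiber) : fiber := fiber_pi (fpsC c *: repr v).

Lemma fiber_scale_pi c m : fiber_scale c (fiber_pi m) = fiber_pi (fpsC c *: m).
Proof.
apply/fiber_piP; have [p e] := repr_fiber_pi m; exists (fpsC c *: p).
by rewrite -scalerBr e !scalerA mulrC.
Qed.
Fact fiber_scaleA a b v : fiber_scale a (fiber_scale b v) = fiber_scale (a * b) v.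
Proof. by rewrite -(fiber_piK v) !fiber_scale_pi scalerA -rmorphM. Qed.
Fact fiber_scale1 : left_id 1 fiber_scale.
Proof. by move=> v; rewrite -(fiber_piK v) fiber_scale_pi rmorph1 scale1r. Qed.
Fact fiber_scaleDr : right_distributive fiber_scale +%R.
Proof.
move=> a v w; rewrite -(fiber_piK v) -(fiber_piK w) -fiber_piD !fiber_scale_pi.
by rewrite scalerDr fiber_piD.
Qed.
Fact fiber_scaleDl v : {morph fiber_scale^~ v : a b / a + b}.
Proof.
by move=> a b; rewrite -(fiber_piK v) !fiber_scale_pi rmorphD scalerDl fiber_piD.
Qed.
HB.instance Definition _ := GRing.Zmodule_isLmodule.Build C fiber
  fiber_scaleA fiber_scale1 fiber_scaleDr fiber_scaleDl.

End Fiber.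

Section Residue.
Variables (C : fieldType) (M : MClog C).

Definition residue (v : fiber M) : fiber M := fiber_pi (nabla (repr v)).

Lemma residue_pi (m : M) : residue (fiber_pi m) = fiber_pi (nabla m).
Proof.
apply/fiber_piP; have [p /eqP] := repr_fiber_pi m; rewrite subr_eq => /eqP->.
exists (p + nabla p); rewrite nablaD addrK nabla_leibniz thetaX.
by rewrite scalerDr.
Qed.

Fact residue_linear : linear residue.
Proof.
move=> c v w; rewrite -(fiber_piK v) -(fiber_piK w).
have sE m : c *: (fiber_pi m : fiber M) = fiber_pi (fpsC c *: m) := fiber_scale_pi c m.
by rewrite sE -fiber_piD !residue_pi nabla_linear fiber_piD sE.
Qed.
HB.instance Definition _ := GRing.isLinear.Build C (fiber M) (fiber M) *:%R residue residue_linear.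

Definition Exp : set C := [set a : C | exists2 v : fiber M, v != 0 & residue v = a *: v].

End Residue.

Definition setominus (C : fieldType) (A B : set C) : set C := [set a - b | a in A & b in B].

Section TensorConnection.
Variables (C : fieldType).
Implicit Types M N : MClog C.

Definition tensor_nabla M N : tensor M N -> tensor M N := tens_nabla nabla nabla.

Lemma tensor_nablaD M N : {morph @tensor_nabla M N : u v / u + v}.
Proof.
exact: (tens_nablaD (@nablaD _ _ _ _ M) (@nablaD _ _ _ _ N)
          (@nabla_leibniz _ _ _ _ M) (@nabla_leibniz _ _ _ _ N)).
Qed.
Fact tensor_nabla_leibniz M N f (u : tensor M N) :
  tensor_nabla (f *: u) = theta f *: u + f *: tensor_nabla u.
Proof.
exact: (tens_nabla_leibniz (@nablaD _ _ _ _ M) (@nablaD _ _ _ _ N)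
          (@nabla_leibniz _ _ _ _ M) (@nabla_leibniz _ _ _ _ N)).
Qed.
Lemma tensor_nablaE M N (m : M) (n : N) :
  tensor_nabla (tens m n) = tens (nabla m) n + tens m (nabla n).
Proof.
exact: (tens_nablaE (@nablaD _ _ _ _ M) (@nablaD _ _ _ _ N)
          (@nabla_leibniz _ _ _ _ M) (@nabla_leibniz _ _ _ _ N)).
Qed.
Fact tensor_nabla_linear M N c (u v : tensor M N) :
  tensor_nabla (fpsC c *: u + v) = fpsC c *: tensor_nabla u + tensor_nabla v.
Proof. by rewrite tensor_nablaD tensor_nabla_leibniz theta_const scale0r add0r. Qed.

Fact tensor_fin_gen M N : fin_gen (tensor M N).
Proof.
have [k [g g_gen]] := conn_fin_gen M; have [l [h h_gen]] := conn_fin_gen N.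
have [tDl tDr tZ] := tens_balanced M N.
have sE c (m : M) (n : N) : c *: tens m n = tens (c *: m) n by exact: tens_scale_tens.
exists #|{: 'I_k * 'I_l}|, (fun i => tens (g (enum_val i).1) (h (enum_val i).2)).
suff gen (u : tensor M N) : exists c : 'I_k * 'I_l -> fps C,
    u = \sum_p c p *: tens (g p.1) (h p.2).
  move=> u; have [c ->] := gen u; exists (c \o enum_val).
  by rewrite (reindex (@enum_val _ {: 'I_k * 'I_l})) //=; apply: onW_bij; apply: enum_val_bij.
move: u; apply: tens_ind.
- by exists (fun=> 0); rewrite big1 // => p _; rewrite scale0r.
- move=> m n; have [c ->] := g_gen m; have [d ->] := h_gen n.
  exists (fun p => c p.1 * d p.2); rewrite tens_suml.
  rewrite -(pair_bigA _ (fun i j => (c i * d j) *: tens (g i) (h j))) /=.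
  apply: eq_bigr => i _; rewrite tens_sumr; apply: eq_bigr => j _.
  by rewrite -tZ scalerA sE mulrC.
- move=> u v [c ->] [d ->]; exists (fun p => c p + d p).
  by rewrite -big_split /=; apply: eq_bigr => i _; rewrite scalerDl.
Qed.

Definition tensor_conn M N : MClog C :=
  @Conn C (fps C) (@fpsC C) (@theta C) (tensor M N) (@tensor_nabla M N)
    (@tensor_nabla_linear M N) (@tensor_nabla_leibniz M N) (tensor_fin_gen M N).

End TensorConnection.

Section Twist.
Variables (C : fieldType) (delta : int).

Definition pole_pred : {pred laurent C} :=
  fun a => `[< exists f, a = laurentX C ^ (- delta) * fps_laurent f >].

Fact pole_closed : submod_closed pole_pred.
Proof.
split=> [|f _ _ /asboolP[g ->] /asboolP[h ->]]; apply/asboolP.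
  by exists 0; rewrite [fps_laurent 0](rmorph0 (@fps_laurent C)) mulr0.
exists (f * g + h); rewrite laurent_scaleE fps_laurentD fps_laurentM mulrDr.
by rewrite mulrCA.
Qed.
HB.instance Definition _ := GRing.isSubmodClosed.Build (fps C) (laurent C) pole_pred pole_closed.

(* The module x^(-delta) C[[x]] underlying 1(delta) *)
Record pole := Pole { pole_val :> laurent C; _ : pole_pred pole_val }.
HB.instance Definition _ := [isSub for pole_val].
HB.instance Definition _ := [Choice of pole by <:].
HB.instance Definition _ := [SubChoice_isSubLmodule of pole by <:].

Lemma pole_valP (a : pole) :
  exists f, pole_val a = laurentX C ^ (- delta) * fps_laurent f.
Proof. by case: a => a /= /asboolP. Qed.

Lemma pole_inj (a b : pole) : pole_val a = pole_val b -> a = b.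
Proof. exact: val_inj. Qed.
Lemma pole_valD (a b : pole) : pole_val (a + b) = pole_val a + pole_val b.
Proof. exact: (raddfD (val : pole -> laurent C)). Qed.
Lemma pole_valZ f (a : pole) : pole_val (f *: a) = f *: pole_val a.
Proof. exact: (linearZ_LR (val : pole -> laurent C)). Qed.

Fact pole_theta_subproof (a : pole) : pole_pred (thetaL (pole_val a)).
Proof.
have [f ->] := pole_valP a; apply/asboolP; exists (theta f - delta%:~R * f).
rewrite thetaLM thetaL_X thetaL_fps fps_laurentB fps_laurentM.
have -> : fps_laurent (delta%:~R : fps C) = delta%:~R := rmorph_int (@fps_laurent C) delta.
by rewrite rmorphN /= mulrBr addrC !mulNr -mulrA mulrCA.
Qed.
Definition pole_theta (a : pole) : pole := Pole (pole_theta_subproof a).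

Lemma pole_thetaE a : pole_val (pole_theta a) = thetaL (pole_val a). Proof. by []. Qed.

Fact pole_theta_leibniz f (a : pole) : pole_theta (f *: a) = theta f *: a + f *: pole_theta a.
Proof. by apply: pole_inj; rewrite pole_valD pole_thetaE !pole_valZ pole_thetaE thetaL_scale. Qed.
Fact pole_thetaD : {morph pole_theta : a b / a + b}.
Proof. by move=> a b; apply: pole_inj; rewrite pole_valD !pole_thetaE pole_valD thetaLD. Qed.
Fact pole_theta_linear c (a b : pole) :
  pole_theta (fpsC c *: a + b) = fpsC c *: pole_theta a + pole_theta b.
Proof. by rewrite pole_thetaD pole_theta_leibniz theta_const scale0r add0r. Qed.

Fact pole_gen_subproof : pole_pred (laurentX C ^ (- delta)).
Proof. by apply/asboolP; exists 1; rewrite fps_laurent1 mulr1. Qed.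
Definition pole_gen : pole := Pole pole_gen_subproof.

Fact pole_fin_gen : fin_gen pole.
Proof.
exists 1%N, (fun=> pole_gen) => a; have [f ef] := pole_valP a; exists (fun=> f).
by rewrite big_ord1; apply: pole_inj; rewrite pole_valZ ef laurent_scaleE mulrC.
Qed.

Definition unit_twist : MClog C :=
  @Conn C (fps C) (@fpsC C) (@theta C) pole pole_theta
    pole_theta_linear pole_theta_leibniz pole_fin_gen.

End Twist.

Definition twist (C : fieldType) (M : MClog C) (delta : int) : MClog C :=
  tensor_conn (unit_twist C delta) M.

(* The canonical isomorphism gamma (M(delta)) = gamma M sends
   a (x) (b (x) m) to ab (x) m. *)
Section TwistIso.
Variables (C : fieldType) (M : MClog C) (delta : int).
Notation X := (laurentX C).
Notation K := (laurent C).
Notation P := (pole C delta).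

Let tKD := @tens_balanced _ K M.
Let tKT := @tens_balanced _ K (twist M delta).
Let tPM := @tens_balanced _ P M.

Definition untwist_inner (a : K) : tensor P M -> locx M :=
  tens_lift (fun (b : P) m => tens (a * pole_val b) m).

Fact untwist_inner_balanced a : balanced (fun (b : P) (m : M) => tens (a * pole_val b) m).
Proof.
have [tD1 tD2 tZ] := tKD; split=> [b b' m|b m m'|f b m].
- by rewrite pole_valD mulrDr tD1.
- by rewrite tD2.
- by rewrite pole_valZ laurent_scaleE mulrCA -tZ laurent_scaleE.
Qed.
Lemma untwist_innerD a : {morph untwist_inner a : u v / u + v}.
Proof. by move=> u v; apply: tens_liftD; exact: untwist_inner_balanced. Qed.
Lemma untwist_innerE a (b : P) (m : M) :
  untwist_inner a (tens b m) = tens (a * pole_val b) m.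
Proof. exact: tens_liftE (untwist_inner_balanced a). Qed.

Definition untwist : locx (twist M delta) -> locx M := tens_lift untwist_inner.

Fact untwist_balanced : balanced (untwist_inner : K -> twist M delta -> locx M).
Proof.
have [tD1 tD2 tZ] := tKD; have [pD1 pD2 pZ] := tPM.
split=> [a a' u|a u v|f a u]; last 1 first; try exact: untwist_innerD.
- move: u; apply: tens_lift_eq => [u v|u v|b m].
  + exact: untwist_innerD.
  + by rewrite scalerDr untwist_innerD.
  have -> : f *: (tens b m : tensor P M) = tens (f *: b) m by exact: tens_scale_tens.
  by rewrite !untwist_innerE pole_valZ !laurent_scaleE mulrCA mulrA.
- move: u; apply: tens_lift_eq => [u v|u v|b m].
  + exact: untwist_innerD.
  + by rewrite !untwist_innerD addrACA.
  by rewrite !untwist_innerE mulrDl tD1.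
Qed.
Lemma untwistD : {morph untwist : u v / u + v}.
Proof. by move=> u v; apply: tens_liftD; exact: untwist_balanced. Qed.
Lemma untwistE a (u : twist M delta) : untwist (tens a u) = untwist_inner a u.
Proof. exact: tens_liftE untwist_balanced. Qed.
Lemma untwist_tens a (b : P) (m : M) :
  untwist (tens a (tens b m : twist M delta)) = tens (a * pole_val b) m.
Proof. by rewrite untwistE untwist_innerE. Qed.

Definition retwist : locx M -> locx (twist M delta) :=
  tens_lift (fun (a : K) (m : M) =>
    tens (a * X ^ delta) (tens (pole_gen C delta) m : twist M delta)).

Fact retwist_balanced : balanced (fun (a : K) (m : M) =>
    tens (a * X ^ delta) (tens (pole_gen C delta) m : twist M delta)).
Proof.
have [tD1 tD2 tZ] := tKT; have [pD1 pD2 pZ] := tPM.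
split=> [a a' m|a m m'|f a m].
- by rewrite mulrDl tD1.
- by rewrite [tens _ (m + m')]pD2 tD2.
- rewrite laurent_scaleE -mulrA -laurent_scaleE tZ; congr tens.
  have -> : f *: (tens (pole_gen C delta) m : tensor P M) = tens (f *: pole_gen C delta) m.
    exact: tens_scale_tens.
  exact: pZ.
Qed.
Lemma retwistD : {morph retwist : u v / u + v}.
Proof. by move=> u v; apply: tens_liftD; exact: retwist_balanced. Qed.
Lemma retwist_tens a (m : M) :
  retwist (tens a m) = tens (a * X ^ delta) (tens (pole_gen C delta) m : twist M delta).
Proof. exact: tens_liftE retwist_balanced. Qed.

Lemma retwistK : cancel retwist untwist.
Proof.
apply: tens_lift_eq => [u v|//|a m]; first by rewrite retwistD untwistD.
by rewrite retwist_tens untwist_tens /= -mulrA -expfzDr ?laurentX_neq0 // subrr expr0z mulr1.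
Qed.

Lemma untwistK : cancel untwist retwist.
Proof.
apply: tens_lift_eq => [u v|//|a u]; first by rewrite untwistD retwistD.
have [tD1 tD2 tZ] := tKT; have [pD1 pD2 pZ] := tPM.
move: u; apply: tens_lift_eq => [u v|u v|b m].
- by rewrite tD2 untwistD retwistD.
- by rewrite tD2.
rewrite untwist_tens retwist_tens; have [f ef] := pole_valP b.
have -> : b = f *: pole_gen C delta.
  by apply: pole_inj; rewrite pole_valZ ef laurent_scaleE mulrC.
have -> : (tens (f *: pole_gen C delta) m : tensor P M) = f *: tens (pole_gen C delta) m.
  exact: esym (tens_scale_tens _ _ _).
rewrite -tZ; congr tens; rewrite pole_valZ !laurent_scaleE /= mulrCA -!mulrA.
by rewrite -expfzDr ?laurentX_neq0 // addNr expr0z mulr1.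
Qed.

Fact untwist_linear : linear untwist.
Proof.
move=> a u v; rewrite untwistD; congr (_ + _); move: u.
apply: tens_lift_eq => [u w|u w|b u].
- by rewrite scalerDr untwistD.
- by rewrite untwistD scalerDr.
have [tD1 tD2 tZ] := tKT; rewrite locx_scaleE; move: u.
apply: tens_lift_eq => [u w|u w|c m].
- by rewrite tD2 untwistD.
- by rewrite tD2 untwistD scalerDr.
by rewrite !untwist_tens locx_scaleE mulrA.
Qed.
HB.instance Definition _ :=
  GRing.isLinear.Build K (locx (twist M delta)) (locx M) *:%R untwist untwist_linear.

Fact retwist_linear : linear retwist.
Proof. by move=> a u v; apply: (can_inj untwistK); rewrite untwist_linear !retwistK. Qed.
HB.instance Definition _ :=
  GRing.isLinear.Build K (locx M) (locx (twist M delta)) *:%R retwist retwist_linear.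

Fact untwist_nabla (u : locx (twist M delta)) :
  untwist (gamma_nabla u) = gamma_nabla (untwist u).
Proof.
have [tD1 tD2 tZ] := tKT; have [kD1 kD2 kZ] := tKD.
move: u; apply: tens_lift_eq => [u v|u v|a u].
- by rewrite gamma_nablaD untwistD.
- by rewrite untwistD gamma_nablaD.
move: u; apply: tens_lift_eq => [u v|u v|b m].
- by rewrite tD2 gamma_nablaD untwistD.
- by rewrite tD2 untwistD gamma_nablaD.
have eN : nabla (tens b m : twist M delta) =
    (tens (pole_theta b) m + tens b (nabla m) : twist M delta).
  exact: (@tensor_nablaE C (unit_twist C delta) M b m).
rewrite gamma_nablaE eN untwistD tD2 untwistD !untwist_tens /= gamma_nablaE.
by rewrite thetaLM kD1 addrA.
Qed.

Fact retwist_nabla (u : locx M) : retwist (gamma_nabla u) = gamma_nabla (retwist u).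
Proof. by apply: (can_inj untwistK); rewrite untwist_nabla !retwistK. Qed.

Definition untwist_hom : conn_hom (gamma (twist M delta)) (gamma M) :=
  @ConnHom _ _ _ _ (gamma (twist M delta)) (gamma M) untwist untwist_nabla.
Definition retwist_hom : conn_hom (gamma M) (gamma (twist M delta)) :=
  @ConnHom _ _ _ _ (gamma M) (gamma (twist M delta)) retwist retwist_nabla.
Definition untwist_iso : conn_iso (gamma (twist M delta)) (gamma M) :=
  @ConnIso _ _ _ _ _ _ untwist_hom retwist_hom untwistK retwistK.

End TwistIso.

Record MCrs (C : fieldType) := MkMCrs {
  rs_conn :> MC C;
  rs_modelP : exists M : MClog C, inhabited (conn_iso (gamma M) rs_conn)
}.

Record log_model (C : fieldType) (E : MC C) := LogModel {
  lm_conn :> MClog C;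
  lm_iso : conn_iso (gamma lm_conn) E
}.

Section Models.
Variables (C : fieldType).

Definition is_lattice (E : MC C) (cE : log_model E) : Prop := free_mod cE.

Definition lm_map (E : MC C) (cE : log_model E) (s : cE) : E :=
  lm_iso cE (tens (1 : laurent C) s).

(* Since 1(delta) lies in C((x)), M(delta) and M have the same localization. *)
Definition twist_model (E : MC C) (cE : log_model E) (delta : int) : log_model E :=
  @LogModel C E (twist cE delta) (iso_comp (lm_iso cE) (untwist_iso cE delta)).

(* gamma Phi, read as an arrow E -> F through the isomorphisms of the models *)
Definition gamma_model (E F : MC C) (cE : log_model E) (cF : log_model F)
    (Phi : conn_hom cE cF) : conn_hom E F :=
  hom_comp (lm_iso cF) (hom_comp (gamma_hom Phi) (iso_inv (lm_iso cE))).

End Models.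

(* Main.v *)
From HB Require Import structures.
Require Import Defs.
From mathcomp Require Import all_boot all_order all_algebra.
From mathcomp Require Import zify.
From mathcomp Require Import boolp classical_sets.

Set Implicit Arguments.
Unset Strict Implicit.
Unset Printing Implicit Defensive.

Import Order.TTheory GRing.Theory Num.Theory.
Local Open Scope ring_scope.
Local Open Scope classical_set_scope.

(** Part (1) is the Leibniz rule: conjugating by [x^k] shifts the connection by
    [k], and [phi] commutes with the connections, so
    [(theta - (rho + k))^mu (x^k phi s) = x^k phi ((theta - rho)^mu s)].

    Parts (2) and (3) both come from one bound: if no integer larger than [N] is
    a difference of an exponent of [cF] and an exponent of [cE], then
    [x^N phi(cE)] lies in [cF] ([pole_bound_exponents]).  As [cE] is finitely
    generated, [x^m phi(cE)] lies in [cF] for [m] large, so it suffices to pass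
    from [m] to [m - 1] when [m > N] ([pole_bound_descent]).  Since [cF] is free
    it embeds in [F], so [s |-> x^m phi(s)] is a linear map [cE -> cF] and
    induces [g : cE / x cE -> cF / x cF].  By the Leibniz rule [g] turns the
    residue of [cE] into the residue of [cF] minus [m].  The image of a
    nonzero such [g] contains an eigenvector of the residue of [cF], with
    eigenvalue [r + m] where [r] is an exponent of [cE] ([shifted_intertwiner_eigen]), which would
    make [m] a difference of exponents.  Hence [g = 0], that is,
    [x^m phi(cE)] lies in [x cF], and one power of [x] can be cancelled in [F].

    Given the bound for [delta], the arrow of (2) sends [s] to the tensor of
    [x^(-delta)] and [x^delta phi(s)].  For (3) the bound holds with [N = 0],
    so [phi] itself maps [cE] to [cF], which gives surjectivity; injectivity
    holds because [cF] embeds in [F]. *)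

(** * Intertwiners and eigenvalues *)

Section SharedEigenvalues.
Variable C : closedFieldType.

(** On a finitely generated space over an algebraically closed field a product of
    factors [A - r] vanishes: lift [A] to a matrix acting on the coefficients
    with respect to the generators, and split its characteristic polynomial
    (Cayley-Hamilton).  The generators may be dependent, so the matrix is only
    one of many lifts of [A]. *)
Lemma split_annihilator (V : lmodType C) (A : {linear V -> V}) : fin_gen V ->
  forall v, exists s : seq C, foldl (fun w r => A w - r *: w) v s = 0.
Proof.
case=> [[|n] [g g_gen]] v.
  by have [c ->] := g_gen v; exists [::]; rewrite /= big_ord0.
have [a aE] : exists a : 'M[C]_n.+1, forall i, A (g i) = \sum_j a i j *: g j.
  have [c cE] := choice (fun i => g_gen (A (g i))).
  by exists (\matrix_(i, j) c i j) => i; rewrite cE; apply: eq_bigr => j _; rewrite mxE.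
pose comb (u : 'rV[C]_n.+1) := \sum_i u 0 i *: g i.
have combA (u : 'rV_n.+1) r : A (comb u) - r *: comb u = comb (u *m (a - r%:M)).
  rewrite mulmxBr mul_mx_scalar /comb linear_sum scaler_sumr /=.
  under [in RHS]eq_bigr do rewrite !mxE scalerBl.
  rewrite sumrB; congr (_ - _); last by apply: eq_bigr => i _; rewrite scalerA.
  under [in RHS]eq_bigr do rewrite scaler_suml.
  rewrite exchange_big; apply: eq_bigr => i _ /=.
  rewrite linearZ /= aE scaler_sumr.
  by apply: eq_bigr => j _; rewrite scalerA.
have combs (u : 'rV_n.+1) s : foldl (fun w r => A w - r *: w) (comb u) s
    = comb (u *m \prod_(r <- s) (a - r%:M)).
  elim: s u => [|r s IHs] u /=; first by rewrite big_nil mulmx1.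
  by rewrite combA IHs big_cons mulmxA.
have [s sE] := closed_field_poly_normal (char_poly a).
have [c cE] := g_gen v; exists s.
have -> : v = comb (\row_i c i) by rewrite cE; apply: eq_bigr => i _; rewrite mxE.
have -> : foldl (fun w r => A w - r *: w) (comb (\row_i c i)) s = comb 0; last first.
  by rewrite /comb big1 // => i _; rewrite mxE scale0r.
rewrite combs; congr comb.
move: (Cayley_Hamilton a); rewrite sE (monicP (char_poly_monic a)) scale1r rmorph_prod /=.
under eq_bigr do rewrite rmorphB /= horner_mx_X horner_mx_C.
by move=> ->; rewrite mulmx0.
Qed.

(** Take [v] with [g v != 0] and a list of roots whose factors [A - r]
    successively kill [v].  The first factor that is not injective has a root
    [r] that is an eigenvalue of [A]; the injective ones are cancelled.  Either
    [g] kills [(A - r) v], and then [g v] is an eigenvector of [B] for [r + d],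
    or [(A - r) v] replaces [v] and the list gets shorter. *)
Lemma shifted_intertwiner_eigen (V W : lmodType C) (A : {linear V -> V}) (B : W -> W)
    (g : V -> W) (d : C) :
  fin_gen V -> g 0 = 0 ->
  (forall r v, g (A v - r *: v) = B (g v) - (r + d) *: g v) ->
  forall v, g v != 0 ->
  exists r, (exists2 v', v' != 0 & A v' = r *: v') /\
            (exists2 w, w != 0 & B w = (r + d) *: w).
Proof.
move=> Vfin g0 gAB v; have [s] := split_annihilator A Vfin v.
elim: s v => [|r s IHs] v /=; first by move=> ->; rewrite g0 eqxx.
have [r_eig | r_reg] := pselect (exists2 v', v' != 0 & A v' = r *: v').
  move=> vs gv; have [gv'|/(IHs _ vs)//] := eqVneq (g (A v - r *: v)) 0.
  exists r; split=> //; exists (g v) => //.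
  by move: gv'; rewrite gAB => /subr0_eq.
(* [A - r] is injective and commutes with the other factors, so it can be
   cancelled: if the other factors did not kill [v], their value at [v] would be
   an eigenvector for [r]. *)
move=> vs; apply: IHs; apply: contrapT => vs0; apply: r_reg.
exists (foldl (fun w r => A w - r *: w) v s); first exact/eqP.
apply: subr0_eq; rewrite -[RHS]vs.
elim: s v {vs vs0} => //= q s IHs v; rewrite IHs; congr foldl.
rewrite !linearB !linearZ /= !scalerA (mulrC q).
by rewrite addrACA.
Qed.

End SharedEigenvalues.

(** * Poles of Laurent series *)

Section Poles.
Variable C : fieldType.
Notation X := (laurentX C).

Lemma fpsX_unit_factor n (f : fps C) :
  fcoef f n != 0 -> (forall i, (i < n)%N -> fcoef f i = 0) ->
  exists2 u : fps C, u \is a GRing.unit & f = fpsX ^+ n * u.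
Proof.
elim: n f => [|n IHn] f fn f0; first by exists f; rewrite ?mul1r.
have [|i lt_in|u u_unit uE] := IHn (Fps (fun i => fcoef f i.+1)) => //=.
  exact: f0.
exists u => //; rewrite exprS -mulrA -uE; apply: fpsP => -[|i].
  by rewrite fcoefM big_ord1 /= mul0r f0.
rewrite fcoefM !big_ord_recl /= mul0r add0r mul1r subn1 big1 ?addr0 // => j _.
by rewrite mul0r.
Qed.

Lemma laurent_clear_pole (a : laurent C) : exists n f, X ^+ n * a = fps_laurent f.
Proof.
have [n dn d0] := fps_ord (lden_neq0 a).
have [u u_unit uE] := fpsX_unit_factor dn d0; exists n, (lnum a * u^-1).
have u0 : fps_laurent u != 0.
  by rewrite fps_laurent_eq0; apply: contraTneq u_unit => ->; rewrite unitr0.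
rewrite [X in _ * X]lnumden uE !fps_laurentM fps_laurentXn invfM.
rewrite mulrCA mulVKf ?expf_neq0 ?laurentX_neq0 //; congr (_ * _).
by apply: (mulfI u0); rewrite divff // -fps_laurentM divrr // fps_laurent1.
Qed.

End Poles.

(** * Logarithmic models inside their connection *)

Section Models.
Variables (C : fieldType).
Notation X := (laurentX C).

Section OneModel.
Variables (E : MC C) (cE : log_model E).

Lemma lm_iso_tens a (s : cE) : lm_iso cE (tens a s) = a *: lm_map s.
Proof. by rewrite -linearZ /= locx_scaleE mulr1. Qed.

Lemma lm_mapD (s t : cE) : lm_map (s + t) = lm_map s + lm_map t.
Proof.
by rewrite /lm_map; have [_ -> _] := tens_balanced (laurent C) cE; rewrite linearD.
Qed.

Lemma lm_mapZ f (s : cE) : lm_map (f *: s) = fps_laurent f *: lm_map s.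
Proof.
rewrite -lm_iso_tens /lm_map; have [_ _ <-] := tens_balanced (laurent C) cE.
by rewrite laurent_scaleE mulr1.
Qed.

Lemma lm_map0 : lm_map (0 : cE) = 0.
Proof. by rewrite -(scale0r (0 : cE)) lm_mapZ rmorph0 scale0r. Qed.

Lemma lm_map_nabla (s : cE) : lm_map (nabla s) = nabla (lm_map s).
Proof.
rewrite /lm_map -hom_nabla; congr (lm_iso cE _).
rewrite [RHS]gamma_nablaE -(fps_laurent1 C) thetaL_fps.
by rewrite (theta_const 1) [fps_laurent 0]rmorph0 tens0l add0r.
Qed.

Lemma lm_map_clear_pole (e : E) : exists n (s : cE), lm_map s = X ^+ n *: e.
Proof.
rewrite -(iso_invK (lm_iso cE) e); move: (iso_inv _ e).
apply: tens_ind => [|a s|u v [n [s sE]] [m [t tE]]].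
- by exists 0%N, 0; rewrite lm_map0 linear0 scaler0.
- have [n [f fE]] := laurent_clear_pole a; exists n, (f *: s).
  by rewrite lm_mapZ -fE lm_iso_tens scalerA.
exists (n + m)%N, (fpsX ^+ m *: s + fpsX ^+ n *: t).
rewrite lm_mapD !lm_mapZ sE tE !fps_laurentXn !scalerA -!exprD.
by rewrite linearD scalerDr [(m + n)%N]addnC.
Qed.

(** The coordinates of a free module are linear, hence extend to its
    localization: [a (x) s] has coordinates [a * co s i]. *)
Lemma lm_map_inj : is_lattice cE -> injective (@lm_map C E cE).
Proof.
case=> n [g g_basis].
pose co (s : cE) := projT1 (cid (g_basis s)).
have coE (s : cE) (c : {ffun _}) : s = \sum_i c i *: g i -> co s = c.
  by rewrite /co; case: cid => c' /= [_ c'_uniq] /c'_uniq.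
have coP (s : cE) : s = \sum_i co s i *: g i by rewrite /co; case: cid => c' [].
have coD (s t : cE) : co (s + t) = [ffun i => co s i + co t i].
  apply: coE; rewrite [in LHS](coP s) [in LHS](coP t) -big_split /=.
  by apply: eq_bigr => i _; rewrite ffunE scalerDl.
have coZ f (s : cE) : co (f *: s) = [ffun i => f * co s i].
  apply: coE; rewrite [in LHS](coP s) scaler_sumr.
  by apply: eq_bigr => i _; rewrite ffunE scalerA.
pose b i (a : laurent C) (s : cE) := a * fps_laurent (co s i).
have b_balanced i : balanced (b i).
  split=> [a a' s|a s t|f a s]; rewrite /b ?coD ?coZ ?ffunE ?fps_laurentD ?fps_laurentM.
  - by rewrite mulrDl.
  - by rewrite mulrDr.
  - by rewrite laurent_scaleE mulrCA mulrA.
move=> s t /(can_inj (iso_homK (lm_iso cE))) st.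
rewrite (coP s) (coP t); apply: eq_bigr => i _; congr (_ *: _).
move/(congr1 (tens_lift (b i))): st; rewrite !tens_liftE // /b !mul1r.
by move/eqP; rewrite -subr_eq0 -fps_laurentB fps_laurent_eq0 subr_eq0 => /eqP.
Qed.

End OneModel.

Lemma gamma_model_lm_map (E F : MC C) (cE : log_model E) (cF : log_model F)
    (Phi : conn_hom cE cF) (s : cE) :
  gamma_model Phi (lm_map s) = lm_map (Phi s).
Proof. by rewrite /= iso_homK /= gamma_funE. Qed.

(** A model generates its connection over [C((x))], so an arrow out of [E] is
    determined by its values on the model. *)
Lemma gamma_model_eq (E F : MC C) (cE : log_model E) (cF : log_model F)
    (Phi : conn_hom cE cF) (phi : conn_hom E F) :
  (forall s : cE, lm_map (Phi s) = phi (lm_map s)) -> gamma_model Phi = phi.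
Proof.
move=> PhiE; apply: homP => e.
rewrite -(iso_invK (lm_iso cE) e); move: (iso_inv _ e).
apply: tens_lift_eq => [u v|u v|a s]; rewrite ?linearD //.
by rewrite lm_iso_tens !linearZ gamma_model_lm_map PhiE.
Qed.

Lemma twist_lm_map (F : MC C) (cF : log_model F) delta (t : cF) :
  @lm_map C F (twist_model cF delta) (tens (pole_gen C delta) t) = X ^ (- delta) *: lm_map t.
Proof. by rewrite /lm_map /= untwist_tens mul1r -/(lm_map t) -lm_iso_tens. Qed.

End Models.

(** * Shifted connections *)

Section ShiftedArrows.
Variables (C : fieldType).
Notation X := (laurentX C).

Lemma lm_map_shift (E : MC C) (cE : log_model E) rho (s : cE) :
  lm_map (shift rho s) = shift rho (lm_map s).
Proof.
rewrite /shift -lm_map_nabla -!scaleNr -rmorphN lm_mapD lm_mapZ.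
by congr (_ + _ *: _); exact: (rmorphN (@laurentC C)).
Qed.

Lemma hom_shift (E F : MC C) (phi : conn_hom E F) rho (e : E) :
  phi (shift rho e) = shift rho (phi e).
Proof. by rewrite /shift linearB linearZ hom_nabla. Qed.

Lemma shift_Xz (E : MC C) rho k (e : E) :
  shift (rho + k%:~R) (X ^ k *: e) = X ^ k *: shift rho e.
Proof.
rewrite /shift nabla_leibniz thetaL_X rmorphD rmorph_int scalerDl !scalerA.
rewrite [_ + X ^ k *: _]addrC [(laurentC rho * _) *: _ + _]addrC addrKA.
by rewrite scalerBr scalerA mulrC.
Qed.

End ShiftedArrows.

(** * Poles of an arrow along two models *)

Section PoleBounds.
Variables (C : fieldType) (E F : MC C) (phi : conn_hom E F).
Variables (cE : log_model E) (cF : log_model F).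
Notation X := (laurentX C).

(** Poles of order at most [m] for the matrix of [phi] in terms of generators of
    the two models; a negative [m] prescribes zeros. *)
Definition pole_bound (m : int) :=
  forall s : cE, exists t : cF, lm_map t = X ^ m *: phi (lm_map s).

Lemma pole_bound_exists : exists n : nat, pole_bound n.
Proof.
have [k [g g_gen]] := conn_fin_gen cE.
have [n nP] := choice (fun i => lm_map_clear_pole cF (phi (lm_map (g i)))).
have [t tP] := choice nP.
(* The sum of the exponents is a convenient common bound for all of them. *)
exists (\sum_i n i)%N => s; have [c ->] := g_gen s.
exists (\sum_i (fpsX ^+ (\sum_j n j - n i) * c i) *: t i).
rewrite !(big_morph _ (@lm_mapD _ _ _) (@lm_map0 _ _ _)) linear_sum scaler_sumr.
apply: eq_bigr => i _; rewrite !lm_mapZ linearZ /= tP !scalerA -exprnP.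
rewrite fps_laurentM fps_laurentXn mulrAC -exprD subnK //.
by rewrite (bigD1 i) //= leq_addr.
Qed.

Lemma pole_boundD m (k : nat) : pole_bound m -> pole_bound (m + k%:Z).
Proof.
move=> mP s; have [t tE] := mP s; exists (fpsX ^+ k *: t).
by rewrite lm_mapZ fps_laurentXn tE scalerA addrC expfzDr ?laurentX_neq0.
Qed.

(** The map [s |-> x^m phi(s)] commutes with the connections only up to [m] times
    itself, the term that comes from differentiating [x^m].  Injectivity of [cF -> F] makes the choice of
    preimages linear. *)
Lemma pole_bound_arrow m : injective (@lm_map C F cF) -> pole_bound m ->
  exists f : {linear cE -> cF},
    (forall s, lm_map (f s) = X ^ m *: phi (lm_map s)) /\
    (forall s, nabla (f s) = f (nabla s) + fpsC m%:~R *: f s).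
Proof.
move=> inj /choice[f fE].
have f_lin : linear f.
  move=> a s t; apply: inj; rewrite lm_mapD lm_mapZ !fE lm_mapD lm_mapZ.
  by rewrite linearD linearZ scalerDr /= !scalerA mulrC.
pose h := HB.pack_for {linear cE -> cF} f (GRing.isLinear.Build _ _ _ _ f f_lin).
exists h; split=> // s; apply: inj.
rewrite lm_map_nabla lm_mapD lm_mapZ /= !fE nabla_leibniz thetaL_X scalerA addrC.
by rewrite -hom_nabla lm_map_nabla -/(laurentC _) rmorph_int.
Qed.

(** [s] goes to the tensor of [x^(-delta)] and [x^delta phi(s)].  The derivative
    of the generator [x^(-delta)] contributes [-delta], which cancels the defect
    [delta] of the second factor. *)
Lemma arrow_into_twist delta : injective (@lm_map C F cF) -> pole_bound delta ->
  exists Phi : conn_hom cE (twist cF delta),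
    gamma_model (cF := twist_model cF delta) Phi = phi.
Proof.
move=> inj /(pole_bound_arrow inj)[f [fE f_nabla]].
have [tD1 tD2 tZ] := tens_balanced (pole C delta) cF.
pose h (s : cE) : twist cF delta := tens (pole_gen C delta) (f s).
have h_lin : linear h.
  move=> a s t; rewrite /h linearP tD2 -tZ; congr (_ + _).
  by symmetry; exact: tens_scale_tens.
pose H := HB.pack_for {linear cE -> twist cF delta} h (GRing.isLinear.Build _ _ _ _ h h_lin).
have theta_gen : pole_theta (pole_gen C delta) = fpsC (- delta%:~R) *: pole_gen C delta.
  apply: pole_inj; rewrite pole_valZ pole_thetaE laurent_scaleE thetaL_X.
  by rewrite -rmorphN -(rmorph_int (@laurentC C)).
have h_nabla s : H (nabla s) = nabla (H s).
  rewrite [RHS](@tensor_nablaE C (unit_twist C delta) cF) /= /h f_nabla tD2 theta_gen.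
  by rewrite addrCA -tZ -tD1 -scalerDl -rmorphD addNr rmorph0 scale0r tens0l addr0.
exists (ConnHom h_nabla); apply: gamma_model_eq => s.
rewrite [LHS]twist_lm_map fE scalerA -expfzDr ?laurentX_neq0 //.
by rewrite addNr scale1r.
Qed.

Lemma arrow_into_lattice : injective (@lm_map C F cF) -> pole_bound 0 ->
  exists Phi : conn_hom cE cF, gamma_model Phi = phi.
Proof.
move=> inj /(pole_bound_arrow inj)[f [fE f_nabla]].
have h_nabla s : f (nabla s) = nabla (f s).
  by rewrite f_nabla rmorph0 scale0r addr0.
exists (ConnHom h_nabla); apply: gamma_model_eq => s.
by rewrite /= fE scale1r.
Qed.

End PoleBounds.

(** * The fiber at the origin *)

Section FiberTheory.
Variables (C : fieldType) (M : lmodType (fps C)).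

Lemma fiber_piZ a (m : M) : fiber_pi (fpsC a *: m) = a *: (fiber_pi m : fiber M).
Proof. by rewrite -[LHS]fiber_scale_pi. Qed.

Lemma fiber_piB (m n : M) : fiber_pi (m - n) = fiber_pi m - fiber_pi n.
Proof. by apply: (addIr (fiber_pi n)); rewrite -fiber_piD !subrK. Qed.

Lemma fiber_pi0 : fiber_pi (0 : M) = 0.
Proof. by rewrite -(subrr (0 : M)) fiber_piB subrr. Qed.

Lemma fiber_fin_gen : fin_gen M -> fin_gen (fiber M).
Proof.
case=> n [g g_gen]; exists n, (fun i => fiber_pi (g i)) => v.
have [c cE] := g_gen (repr v); exists (fun i => fcoef (c i) 0).
rewrite -(fiber_piK v) cE (eq_bigr _ (fun i _ => esym (fiber_piZ _ _))) /=.
rewrite -(big_morph _ (@fiber_piD C M) fiber_pi0).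
(* A power series [c] differs from its constant term by [x] times its shift. *)
apply/fiber_piP; exists (\sum_i Fps (fun j => fcoef (c i) j.+1) *: g i).
rewrite scaler_sumr -sumrB; apply: eq_bigr => i _; rewrite -scalerBl scalerA.
congr (_ *: _); apply: fpsP => -[|j].
  by rewrite fcoefD fcoefN /= big_ord1 mul0r subrr.
rewrite fcoefD fcoefN /= subr0 !big_ord_recl /= mul0r add0r mul1r subn1 big1 ?addr0 // => k _.
by rewrite mul0r.
Qed.

End FiberTheory.

(** * Exponents bound the poles *)

Section Descent.
Variables (C : closedFieldType) (E F : MC C) (phi : conn_hom E F).
Variables (cE : log_model E) (cF : log_model F).
Hypothesis cF_inj : injective (@lm_map C F cF).
Notation X := (laurentX C).

(** Modulo [x] the map [s |-> x^m phi(s)] intertwines the residues up to the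
    shift [m].  As [m] is not a difference of exponents, this reduction is zero,
    so [x^m phi(s)] is divisible by [x] in [cF]. *)
Lemma pole_bound_descent (m : int) :
  ~ setominus (Exp cF) (Exp cE) m%:~R ->
  pole_bound phi cE cF m -> pole_bound phi cE cF (m - 1).
Proof.
move=> m_reg /(pole_bound_arrow cF_inj)[f [fE f_nabla]].
pose g (v : fiber cE) : fiber cF := fiber_pi (f (repr v)).
have g_pi s : g (fiber_pi s) = fiber_pi (f s).
  apply/fiber_piP; have [p pE] := repr_fiber_pi s; exists (f p).
  by rewrite -linearB pE linearZ.
have g0 : g 0 = 0 by rewrite -fiber_pi0 g_pi linear0 fiber_pi0.
have gAB r v : g (@residue C cE v - r *: v) = residue (g v) - (r + m%:~R) *: g v.
  rewrite -(fiber_piK v) residue_pi -fiber_piZ -fiber_piB !g_pi residue_pi.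
  rewrite -fiber_piZ -fiber_piB f_nabla.
  by rewrite linearB linearZ rmorphD scalerDl /= [fpsC r *: _ + _]addrC addrKA.
have g_eq0 v : g v = 0.
  apply/eqP/negPn/negP => gv; apply: m_reg.
  have [r [[v' v'0 rv'] [w w0 rw]]] :=
    shifted_intertwiner_eigen (fiber_fin_gen (conn_fin_gen cE)) g0 gAB gv.
  exists (r + m%:~R); first by exists w.
  by exists r; [exists v' | rewrite addrAC subrr add0r].
move=> s; have := g_eq0 (fiber_pi s); rewrite g_pi -fiber_pi0 => /fiber_piP[t].
rewrite subr0 => ft; exists t.
have X0 := laurentX_neq0 C.
have -> : X ^ (m - 1) = X^-1 * X ^ m by rewrite addrC expfzDr.
by rewrite -scalerA -fE ft lm_mapZ scalerA mulVf // scale1r.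
Qed.

(** Start from an arbitrary bound, weakened to [N] plus a natural number [k],
    and descend [k] times. *)
Lemma pole_bound_exponents (N : int) :
  (forall m : int, N < m -> ~ setominus (Exp cF) (Exp cE) m%:~R) ->
  pole_bound phi cE cF N.
Proof.
move=> N_max; have [n nP] := pole_bound_exists phi cE cF.
have : pole_bound phi cE cF (N + (`|N| + n)%N%:Z).
  have -> : N + (`|N| + n)%N%:Z = n%:Z + `|N + `|N|%:Z|%:Z by lia.
  exact: pole_boundD.
elim: (_ + n)%N => [|k IHk] kP; first by rewrite addr0 in kP.
apply: IHk; have -> : N + k%:Z = N + k.+1%:Z - 1 by lia.
by apply: pole_bound_descent kP; apply: N_max; lia.
Qed.

End Descent.

Theorem proposition4p4 (C : closedFieldType) (charC0 : [pchar C] =i pred0)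
    (E F : MCrs C) (phi : conn_hom E F) (cE : log_model E) (cF : log_model F)
    (latF : is_lattice cF) :
  [/\ forall (rho : C) (s : cE) (mu : nat),
        Exp cE rho ->
        [set fpsX *: t | t in [set: cE]] (iter mu (shift rho) s) ->
        forall k : int,
          [set laurentX C ^ (k + 1) *: phi (lm_map t) | t in [set: cE]]
            (iter mu (shift (rho + k%:~R)) (laurentX C ^ k *: phi (lm_map s))),
      forall delta : int,
        setominus (Exp cF) (Exp cE) delta%:~R ->
        (forall n : int, setominus (Exp cF) (Exp cE) n%:~R -> n <= delta) ->
        [set laurentX C ^ delta *: phi (lm_map s) | s in [set: cE]]
          `<=` [set lm_map t | t in [set: cF]] /\
        exists Phi : conn_hom cE (twist cF delta),
          gamma_model (cF := twist_model cF delta) Phi = phi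
    & (forall n : int, 0 < n -> ~ setominus (Exp cF) (Exp cE) n%:~R) ->
      bijective (fun Phi : conn_hom cE cF => gamma_model Phi)].
Proof.
have inj := lm_map_inj latF.
split=> [rho s mu _ [t _ tE] k|delta _ delta_max|Exp_le0].
- exists t => //.
  have -> : iter mu (shift (rho + k%:~R)) (laurentX C ^ k *: phi (lm_map s))
      = laurentX C ^ k *: phi (lm_map (iter mu (shift rho) s)).
    elim: mu {tE} => //= mu ->.
    by rewrite shift_Xz -hom_shift -lm_map_shift.
  rewrite -tE lm_mapZ linearZ /= scalerA.
  by rewrite expfzDr ?laurentX_neq0.
- have bound : pole_bound phi cE cF delta.
    apply: (pole_bound_exponents phi inj) => m lt_m /delta_max.
    by rewrite leNgt lt_m.
  split; last exact: arrow_into_twist.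
  by move=> _ [s _ <-]; have [t tE] := bound s; exists t.
have surj psi : exists Phi : conn_hom cE cF, gamma_model Phi = psi.
  exact/(arrow_into_lattice inj)/(pole_bound_exponents psi inj).
have [inv invK] := choice surj.
exists inv => // Phi; apply: homP => s; apply: inj.
by rewrite -!gamma_model_lm_map invK.
Qed.
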